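(* Any periodic element of $\mathcal G$ is the product of at most $2$ involutions of $\mathcal G$. Any IET that is reversible in $\mathcal G$ can be written as a product of $4$ involutions of $\mathcal G$.
   Context: An interval exchange transformation (IET) is a bijection of $[0,1)$ defined by a finite partition of $[0,1)$ into half-open subintervals and a reordering of these intervals by translations; $\mathcal G$ is the group of all IETs. $f\in\mathcal G$ is reversible in $\mathcal G$ if there is $h\in\mathcal G$ with $hfh^{-1}=f^{-1}$. An element of $\mathcal G$ is periodic if it has finite order; an involution is an element whose square is the identity. *)

(* Defs.v *)
From HB Require Import structures.
From mathcomp Require Import all_boot all_order all_algebra.
From mathcomp Require Import lra.
From mathcomp Require Import boolp classical_sets reals numfun.

Set Implicit Arguments.
Unset Strict Implicit.
Unset Printing Implicit Defensive.

Import Order.TTheory GRing.Theory Num.Theory.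
Local Open Scope ring_scope.

Section GroupNotions.
Variable G : groupType.
Implicit Types f h : G.
Local Open Scope group_scope.

Definition periodic f := exists2 n : nat, (0 < n)%N & f ^+ n = 1.

(* The identity counts as an involution. *)
Definition involution f := f ^+ 2 = 1.

Definition reversible f := exists h, h * f * h^-1 = f^-1.

Definition involution_product (n : nat) f :=
  exists2 t : n.-tuple G, (forall i, involution (tnth t i))
                        & f = \prod_(i < n) tnth t i.

End GroupNotions.

Definition unit_itv (R : realType) := {x : R | 0 <= x < 1}.

(* [itv_partition 0 1 s] says that 0 :: s is the increasing sequence of        *)
(* endpoints 0 < s_1 < ... < s_k = 1, so that the intervals of the partition   *)
(* are the k = size s intervals between consecutive entries of 0 :: s.         *)
Definition piecewise_translation (R : realType)
    (f : unit_itv R -> unit_itv R) :=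
  exists2 s : seq R, itv_partition 0 1 s &
    forall i, (i < size s)%N -> exists d : R, forall x : unit_itv R,
      nth 1 (0 :: s) i <= val x < nth 1 (0 :: s) i.+1 -> val (f x) = val x + d.

Record iet (R : realType) := Iet {
  iet_fun :> unit_itv R -> unit_itv R;
  iet_bij : bijective iet_fun;
  iet_pt : piecewise_translation iet_fun }.

Section IetGroup.
Variable R : realType.
Local Notation I := (unit_itv R).
Implicit Types f g h : iet R.

Lemma ietP f g : (f : I -> I) =1 g <-> f = g.
Proof.
split=> [/funext|->//]; case: f g => [f bf pf] [g bg pg] /= fg.
by case: g / fg bg pg => bg pg; congr Iet; exact: Prop_irrelevance.
Qed.

HB.instance Definition _ := gen_eqMixin (iet R).
HB.instance Definition _ := gen_choiceMixin (iet R).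

(* Piecewise translations in terms of an unordered finite set of break points. *)
Definition breaks (D : seq R) (f : I -> I) := forall x y : I, val x <= val y ->
  (forall c, c \in D -> ~~ (val x < c <= val y)) ->
  val (f y) - val (f x) = val y - val x.

Lemma itv_partition_cover (a x : R) s : itv_partition a 1 s -> a <= x < 1 ->
  exists2 i, (i < size s)%N & nth 1 (a :: s) i <= x < nth 1 (a :: s) i.+1.
Proof.
elim: s a => [a|b s IH a] /=.
  by move=> /itv_partition_nil ->; rewrite leNgt; case: ltP.
move=> /itv_partition_cons /IH {}IH /andP[ax x1].
have [bx|xb] := leP b x; last by exists 0%N; rewrite //= ax xb.
by have [|i si xi] := IH; [rewrite bx|exists i.+1].
Qed.

Lemma pt_breaks (f : I -> I) : piecewise_translation f -> exists D, breaks D f.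
Proof.
move=> [s s01 fs]; exists s => x y xy Dxy.
have [i si /andP[ix xi]] := itv_partition_cover s01 (valP x).
have [d fd] := fs i si.
have yi : val y < nth 1 (0 :: s) i.+1.
  rewrite ltNge; apply/negP => iy.
  by have := Dxy _ (mem_nth 1 si); rewrite xi iy.
rewrite !fd ?ix ?xi ?yi ?(le_trans ix) //.
by rewrite opprD addrACA subrr addr0.
Qed.

Lemma breaks_pt D (f : I -> I) : breaks D f -> piecewise_translation f.
Proof.
move=> Df; pose u := sort <=%R (undup [seq c <- D | 0 < c < 1]).
have mu c : (c \in u) = (0 < c < 1) && (c \in D).
  by rewrite mem_sort mem_undup mem_filter.
have us : sorted <%R u by rewrite sort_lt_sorted undup_uniq.
have Ps : path <%R 0 (rcons u 1).
  rewrite rcons_path path_min_sorted ?us /=; last first.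
    by apply/allP => c; rewrite mu => /andP[/andP[]].
  have : last 0 u \in 0 :: u by rewrite mem_last.
  by rewrite inE => /predU1P[->|]; rewrite ?ltr01// mu => /andP[/andP[]].
exists (rcons u 1); first by split=> //; rewrite last_rcons.
move=> i si; set s := rcons u 1 in Ps si *.
have Ss : sorted <%R (0 :: s) by [].
have s1 c : c \in s -> 0 < c <= 1.
  rewrite mem_rcons inE mu => /predU1P[->|/andP[/andP[-> /ltW->]]//].
  by rewrite ltr01 lexx.
have p0 : 0 <= nth 1 (0 :: s) i.
  by case: i si => //= i /ltnW si; have /andP[/ltW] := s1 _ (mem_nth 1 si).
have [p1|p1] := ltP (nth 1 (0 :: s) i) 1; last first.
  exists 0 => x /andP[ix _]; have /andP[_] := valP x.
  by rewrite ltNge (le_trans p1 ix).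
have p01 : 0 <= nth 1 (0 :: s) i < 1 by rewrite p0 p1.
pose p : I := Sub (nth 1 (0 :: s) i) p01.
exists (val (f p) - val p) => x /andP[ix xi].
suff : val (f x) - val (f p) = val x - val p by rewrite /=; lra.
apply: Df => //= c cD; apply/negP => /andP[ic cx].
have : c \in s.
  rewrite mem_rcons inE mu cD (le_lt_trans p0 ic) /=.
  by have /andP[_ /(le_lt_trans cx)->] := valP x; rewrite orbT.
move=> /(nthP 1)[j js cj].
have : (i < j.+1)%N.
  by rewrite -(lt_sorted_ltn_nth 1 Ss) ?inE ?ltnS//= ?cj// ltnW.
rewrite ltnS => ij.
have : nth 1 (0 :: s) i.+1 <= nth 1 (0 :: s) j.+1.
  by rewrite (lt_sorted_leq_nth 1 Ss) ?inE ?ltnS.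
by rewrite /= cj => /(lt_le_trans xi); rewrite ltNge cx.
Qed.

Lemma pt_id : piecewise_translation (@id I).
Proof. exact: (@breaks_pt [::]). Qed.

Lemma pt_comp (f g : I -> I) : bijective f ->
  piecewise_translation f -> piecewise_translation g ->
  piecewise_translation (g \o f).
Proof.
move=> [f' fK f'K] /pt_breaks[D Df] /pt_breaks[E Eg].
pose E' := [seq val (f' c) | c <- pmap insub E].
apply: (@breaks_pt (D ++ E')) => x y xy DE /=.
have Dxy c : c \in D -> ~~ (val x < c <= val y).
  by move=> cD; apply: DE; rewrite mem_cat cD.
have fxy := Df _ _ xy Dxy.
have lefxy : val (f x) <= val (f y) by rewrite -subr_ge0 fxy subr_ge0.
rewrite -fxy; apply: Eg => // c cE; apply/negP => /andP[xc cy].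
have c01 : 0 <= c < 1.
  have /andP[x0 _] := valP (f x); have /andP[_ y1] := valP (f y).
  by rewrite (le_trans x0 (ltW xc)) (le_lt_trans cy y1).
have z01 : 0 <= val x + (c - val (f x)) < 1.
  have /andP[x0 _] := valP x; have /andP[_ y1] := valP y.
  by apply/andP; split; lra.
pose z : I := Sub (val x + (c - val (f x))) z01.
have xz : val x < val z <= val y by rewrite SubK; apply/andP; split; lra.
have fz : val (f z) = c.
  have := @Df x z; rewrite ltW; last by case/andP: xz.
  suff Dxz k : k \in D -> ~~ (val x < k <= val z).
    by move=> /(_ isT Dxz) /=; lra.
  move=> /Dxy; apply: contra => /andP[-> kz] /=.
  by case/andP: xz => _; exact: le_trans.
suff zE : val z \in D ++ E' by have := DE _ zE; rewrite xz.
rewrite mem_cat; apply/orP; right; apply/mapP.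
exists (f z); last by rewrite fK.
by rewrite mem_pmap_sub fz.
Qed.

Lemma pt_inv (f f' : I -> I) : cancel f f' -> cancel f' f ->
  piecewise_translation f -> piecewise_translation f'.
Proof.
move=> fK f'K [s s01 fs].
pose di i := xget 0 (fun d : R => forall x : I,
  nth 1 (0 :: s) i <= val x < nth 1 (0 :: s) i.+1 -> val (f x) = val x + d).
pose D := [seq nth 1 (0 :: s) i.+1 + di i | i <- iota 0 (size s)].
apply: (@breaks_pt D) => u v uv Duv.
have [i si /andP[ix xi]] := itv_partition_cover s01 (valP (f' u)).
have fd x : nth 1 (0 :: s) i <= val x < nth 1 (0 :: s) i.+1 ->
    val (f x) = val x + di i.
  by rewrite /di; case: xgetP => [d _ /(_ x)//|no]; have [d /no] := fs i si.
have uE : val u = val (f' u) + di i by rewrite -fd ?ix// f'K.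
have ve : val v < nth 1 (0 :: s) i.+1 + di i.
  rewrite ltNge; apply/negP => ev.
  have /Duv : nth 1 (0 :: s) i.+1 + di i \in D.
    by apply/mapP; exists i; rewrite // mem_iota.
  by rewrite ev andbT uE ltrD2r xi.
have yi : nth 1 (0 :: s) i <= val v - di i < nth 1 (0 :: s) i.+1.
  by apply/andP; split; lra.
have y01 : 0 <= val v - di i < 1.
  have /andP[x0 _] := valP (f' u).
  have s1 : nth 1 (0 :: s) i.+1 <= 1 by exact: itv_partition_nth_le s01.
  by apply/andP; split; lra.
pose y : I := Sub (val v - di i) y01.
have -> : f' v = y.
  by apply: (can_inj fK); rewrite f'K; apply: val_inj; rewrite fd //= subrK.
by rewrite /y SubK; lra.
Qed.

Definition iet1 : iet R := Iet (Bijective (fun=> erefl) (fun=> erefl)) pt_id.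

Definition iet_mul f g : iet R :=
  Iet (bij_comp (iet_bij f) (iet_bij g))
      (pt_comp (iet_bij g) (iet_pt g) (iet_pt f)).

Lemma iet_inv_exists f : exists g : iet R, cancel f g /\ cancel g f.
Proof.
have [g fK gK] := iet_bij f.
by exists (Iet (Bijective gK fK) (pt_inv fK gK (iet_pt f))).
Qed.

Definition iet_inv f : iet R := projT1 (cid (iet_inv_exists f)).

Lemma iet_invK f : cancel f (iet_inv f).
Proof. by rewrite /iet_inv; case: cid => g []. Qed.

Lemma iet_invKV f : cancel (iet_inv f) f.
Proof. by rewrite /iet_inv; case: cid => g []. Qed.

Fact iet_mulA : associative iet_mul.
Proof. by move=> f g h; apply/ietP. Qed.

Fact iet_mul1l : left_id iet1 iet_mul.
Proof. by move=> f; apply/ietP. Qed.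

Fact iet_mulr1 : right_id iet1 iet_mul.
Proof. by move=> f; apply/ietP. Qed.

Fact iet_mulV : left_inverse iet1 iet_inv iet_mul.
Proof. by move=> f; apply/ietP => x; exact: iet_invK. Qed.

Fact iet_mulrV : right_inverse iet1 iet_inv iet_mul.
Proof. by move=> f; apply/ietP => x; exact: iet_invKV. Qed.

HB.instance Definition _ := isGroup.Build (iet R)
  iet_mulA iet_mul1l iet_mulr1 iet_mulV iet_mulrV.

Lemma iet1E (x : I) : (1%g : iet R) x = x. Proof. by []. Qed.

Lemma ietME f g (x : I) : (f * g)%g x = f (g x). Proof. by []. Qed.

End IetGroup.

(* Main.v *)
(* An IET f with f^N = 1 is inverted by the involution that sends f^i m to    *)
(* f^-i m, where m is the least point of the orbit; hence f is a product of   *)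
(* two involutions. If h f h^-1 = f^-1, it then suffices to replace h by a    *)
(* periodic map g inverting f, since f = (f g) g^-1 and (f g)^2 = g^2. On the *)
(* periodic points of f, g is the reflection above. Elsewhere h permutes the  *)
(* finitely many orbits along which the discontinuities of f do not cancel,   *)
(* so for some even q > 0 each of their points satisfies h^q x = f^s x for    *)
(* some s. The set where s = 0 is kept, and h swaps the set where s > 0 with  *)
(* the set where s < 0. On the remaining set the number of discontinuities of *)
(* f^n is bounded in n, so that some f^n with n > 0 moves most points by      *)
(* little; the sign of f^n x - x is then f-invariant, and h reverses it.      *)
(* Whenever h swaps two f-invariant sets A and A', take g = h on A and g =    *)
(* h^-1 on A'.                                                                *)
Require Import Defs.
From mathcomp Require Import all_boot all_order all_algebra.
From mathcomp Require Import lra zify.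
From mathcomp Require Import boolp reals.

Set Implicit Arguments.
Unset Strict Implicit.
Unset Printing Implicit Defensive.

Import Order.TTheory GRing.Theory Num.Theory.
Local Open Scope ring_scope.

(** A reversing [h] becomes periodic after cutting along [f]-invariant sets; off the periodic points
    of [f], a sign is needed that [f] preserves and [h] reverses. There are two sources of it. An
    orbit whose discontinuities do not cancel contains a discontinuity of [f], so there are finitely
    many such orbits and [h] permutes them; on them an even power of [h] acts as a power of [f]
    ([fund_return]), and the sign of its exponent serves. Where discontinuities cancel, those of
    [f^n] stay within finitely many points of the start or the end of the orbit segment
    ([disc_powers]), so a pigeonhole on a grid yields [f^n] close to the identity, and the direction
    in which it moves points serves ([sign_set]). All sets involved are finite unions of half-open
    intervals ([simple]), so the glued maps are IETs ([pt_if]); for periodic points this rests on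
    [periodic_points_bound]. [periodic_reverser] does the gluing, and [periodic_involutions],
    applied to [f * g] and [g^-1], yields the four involutions. *)

Section Cells.
Variable R : realType.
Local Notation I := (unit_itv R).
Implicit Types (f g h : iet R) (D : seq R) (x y : I) (A B : I -> Prop).

(** * Cells of a finite set, simple sets, and periodic elements *)

Lemma ietK f : cancel f (f^-1)%g. Proof. exact: iet_invK. Qed.

Lemma ietVK f : cancel (f^-1)%g f. Proof. exact: iet_invKV. Qed.

Lemma iet_inj f : injective f. Proof. exact: can_inj (ietK f). Qed.

Lemma ietXD f m n x : (f ^+ (m + n))%g x = (f ^+ m)%g ((f ^+ n)%g x).
Proof. by rewrite expgnDr. Qed.

Lemma ietXS f n x : (f ^+ n.+1)%g x = f ((f ^+ n)%g x).
Proof. by rewrite expgS. Qed.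

Lemma ietXSr f n x : (f ^+ n.+1)%g x = (f ^+ n)%g (f x).
Proof. by rewrite expgSr. Qed.

Lemma ietXM f m n x : (f ^+ n)%g x = x -> (f ^+ (m * n))%g x = x.
Proof. by move=> fx; elim: m => // m IH; rewrite mulSn ietXD IH. Qed.

Definition same_cell D x y := {in D, forall c, (c <= val x) = (c <= val y)}.

(** These are the finite unions of half-open intervals, along which IETs can be cut and glued. *)
Definition simple A := exists D, forall x y, same_cell D x y -> A x -> A y.

Lemma same_cell_sym D x y : same_cell D x y -> same_cell D y x.
Proof. by move=> xy c cD; rewrite xy. Qed.

Lemma same_cell_trans D x y z :
  same_cell D x y -> same_cell D y z -> same_cell D x z.
Proof. by move=> xy yz c cD; rewrite xy ?yz. Qed.

Lemma same_cell_sub D E x y :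
  {subset E <= D} -> same_cell D x y -> same_cell E x y.
Proof. by move=> ED xy c /ED /xy. Qed.

Lemma same_cell_catl D E x y : same_cell (D ++ E) x y -> same_cell D x y.
Proof. by apply: same_cell_sub => c; rewrite mem_cat => ->. Qed.

Lemma same_cell_catr D E x y : same_cell (D ++ E) x y -> same_cell E x y.
Proof. by apply: same_cell_sub => c; rewrite mem_cat orbC => ->. Qed.

Lemma breaks_cell D (f : I -> I) x y : breaks D f -> same_cell D x y ->
  val (f y) - val (f x) = val y - val x.
Proof.
move=> Df; wlog xy : x y / val x <= val y => [H xyD|xyD].
  have [|/ltW yx] := leP (val x) (val y) => [/H|]; first exact.
  by have := H _ _ yx (same_cell_sym xyD); lra.
by apply: Df => // c /xyD <-; rewrite ltNge; case: leP.
Qed.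

Lemma cell_breaks D (f : I -> I) :
  (forall x y, same_cell D x y -> val (f y) - val (f x) = val y - val x) ->
  breaks D f.
Proof.
move=> fD x y xy Dxy; apply: fD => c /Dxy.
by case: ltP => //= [xc|cx _]; [case: (c <= _)|rewrite (le_trans cx)].
Qed.

Lemma simple_and A B : simple A -> simple B -> simple (fun x => A x /\ B x).
Proof.
move=> [D DA] [E EB]; exists (D ++ E) => x y xy [Ax Bx]; split.
  exact: DA (same_cell_catl xy) Ax.
exact: EB (same_cell_catr xy) Bx.
Qed.

Lemma simple_not A : simple A -> simple (fun x => ~ A x).
Proof.
by move=> [D DA]; exists D => x y /same_cell_sym xy nAx /(DA _ _ xy).
Qed.

Lemma simple_or A B : simple A -> simple B -> simple (fun x => A x \/ B x).
Proof.
move=> [D DA] [E EB]; exists (D ++ E) => x y xy [Ax|Bx]; [left|right].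
  exact: DA (same_cell_catl xy) Ax.
exact: EB (same_cell_catr xy) Bx.
Qed.

Lemma simple_ex_lt (A : nat -> I -> Prop) n : (forall i, simple (A i)) ->
  simple (fun x => exists2 i, (i < n)%N & A i x).
Proof.
move=> sA; elim: n => [|n [D IH]]; first by exists [::] => x y _ [].
have [E EA] := sA n; exists (D ++ E) => x y xy [i].
rewrite ltnS leq_eqVlt => /predU1P[->|ltin] Ai.
  by exists n => //; apply: EA (same_cell_catr xy) Ai.
have [|j jn Aj] := IH _ _ (same_cell_catl xy); first by exists i.
by exists j => //; apply: ltnW.
Qed.

Lemma iet_breaks f : exists D, breaks D f.
Proof. exact: pt_breaks (iet_pt f). Qed.

Lemma simple_eq f g : simple (fun x => f x = g x).
Proof.
have [D Df] := iet_breaks f; have [E Eg] := iet_breaks g.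
exists (D ++ E) => x y xy fg; apply: val_inj.
have := breaks_cell Df (same_cell_catl xy).
have := breaks_cell Eg (same_cell_catr xy).
rewrite fg; lra.
Qed.

Lemma pt_if A (u v : I -> I) : simple A ->
  piecewise_translation u -> piecewise_translation v ->
  piecewise_translation (fun x => if `[<A x>] then u x else v x).
Proof.
move=> [D DA] /pt_breaks[E Eu] /pt_breaks[F Fv].
apply: (@breaks_pt _ (D ++ E ++ F)); apply: cell_breaks => x y xy.
have -> : `[<A y>] = `[<A x>].
  move/same_cell_catl in xy; apply: asbool_equiv_eq; split; apply: DA => //.
  exact: same_cell_sym.
move/same_cell_catr in xy; case: ifP => _;
  [apply: breaks_cell Eu _|apply: breaks_cell Fv _].
  exact: same_cell_catl xy.
exact: same_cell_catr xy.
Qed.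

Lemma iet_of_iter (u : I -> I) n : piecewise_translation u ->
  iter n.+1 u =1 id -> exists g : iet R, g =1 u.
Proof.
move=> pu un; suff bu : bijective u by exists (Iet bu pu).
by exists (iter n u) => x; rewrite -?iterS -?iterSr un.
Qed.

Lemma iet_fun_iter g n : (g ^+ n)%g =1 iter n g.
Proof. by elim: n => // n IH x; rewrite ietXS IH. Qed.

(* The reflection maps x to f ^+ (i + i) x, where f ^+ i x is the least point *)
(* of the orbit; i can be chosen constant on each common cell of the f ^+ j.  *)
Lemma periodic_reflection f : periodic f -> exists t : iet R,
  [/\ involution t, (f * t * f = t)%g & forall x, exists i, t x = (f ^+ i)%g x].
Proof.
move=> [N N0 fN].
have fNx x : (f ^+ N)%g x = x by rewrite fN.
pose low i x := forall j, val ((f ^+ i)%g x) <= val ((f ^+ j)%g x).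
have low_ex x : exists i, low i x.
  pose i0 : 'I_N := Ordinal N0.
  case: (arg_minP (fun i : 'I_N => val ((f ^+ i)%g x)) (i0 := i0) (P :=
    predT) isT) => i _ imin.
  exists i => j; rewrite (divn_eq j N) addnC ietXD (ietXM _ (fNx x)).
  by have := imin (Ordinal (ltn_pmod j N0)) isT.
have low_uniq x i j : low i x -> low j x ->
  (f ^+ (i + i))%g x = (f ^+ (j + j))%g x.
  move=> li lj; have ij : (f ^+ i)%g x = (f ^+ j)%g x.
    by apply: val_inj; apply/eqP; rewrite eq_le li lj.
  by rewrite ietXD ij -ietXD addnC ietXD ij -ietXD.
pose k x := projT1 (cid (low_ex x)).
have lowk x : low (k x) x by rewrite /k; case: cid.
pose t x := (f ^+ (k x + k x))%g x.
have tE x i : low i x -> t x = (f ^+ (i + i))%g x by move=> li; apply: low_uniq.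
clearbody t.
have tt x : t (t x) = x.
  have tx := tE _ _ (lowk x); move: (k x) (lowk x) tx => i li ->.
  have iN : (N.-1 * i + i = i * N)%N by rewrite addnC -mulSn prednK// mulnC.
  (* [N.-1 * i] stands for [-i] modulo [N]: from [f^(i + i) x] the least point is [i] steps back. *)
  rewrite (@tE _ (N.-1 * i)%N).
    by rewrite -ietXD addnACA iN -mulnDl ietXM.
  by move=> j; rewrite -!ietXD addnA iN addnC ietXD ietXM.
have ftf x : f (t (f x)) = t x.
  have tx := tE _ _ (lowk x); move: (k x) (lowk x) tx => i li ->.
  have NE : (i + N.-1).+1 = (i + N)%N by rewrite -addnS prednK.
  (* Seen from [f x] the least point comes one step earlier; [i + N.-1] stands for [i - 1]. *)
  rewrite (@tE _ (i + N.-1)%N).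
    have -> : f ((f ^+ (i + N.-1 + (i + N.-1)))%g (f x)) =
        (f ^+ (i + i + (N + N)))%g x.
      by rewrite -ietXSr -ietXS; congr ((f ^+ _)%g x); lia.
    by rewrite (ietXD f _ (N + N)) (ietXD f N) !fNx.
  by move=> j; rewrite -!ietXSr NE ietXD fNx; apply: li.
have pt_t : piecewise_translation t.
  have [D Df] : exists D, forall i, (i < N)%N -> breaks D (f ^+ i)%g.
    elim: {+}N => [|n [D IH]]; first by exists [::].
    have [E Ef] := iet_breaks (f ^+ n)%g; exists (D ++ E) => i.
    rewrite ltnS leq_eqVlt => /predU1P[->|/IH Di]; apply: cell_breaks => x y xy.
      exact: breaks_cell Ef (same_cell_catr xy).
    exact: breaks_cell Di (same_cell_catl xy).
  have fD i x y : same_cell D x y ->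
      val ((f ^+ i)%g y) - val ((f ^+ i)%g x) = val y - val x.
    have iE z : (f ^+ i)%g z = (f ^+ (i %% N))%g z.
      by rewrite {1}(divn_eq i N) addnC ietXD (ietXM _ (fNx z)).
    by rewrite !iE; apply: breaks_cell; apply: Df; rewrite ltn_pmod.
  apply: (@breaks_pt _ D); apply: cell_breaks => x y xy.
  (* Passing from [x] to [y] shifts all iterates by the same amount, so the same index gives the
     least one. *)
  have ly : low (k x) y.
    move=> j; have := lowk x j; have := fD j _ _ xy; have := fD (k x) _ _ xy.
    by lra.
  by rewrite (tE _ _ ly) (tE _ _ (lowk x)); apply: fD.
have [g gt] := @iet_of_iter t 1 pt_t tt.
exists g; split.
- by rewrite /involution expg2; apply/ietP => x; rewrite ietME !gt tt.
- by apply/ietP => x; rewrite !ietME !gt ftf.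
- by move=> x; exists (k x + k x)%N; rewrite gt; apply: tE.
Qed.

(** With [t] the reflection, [f = t (t f)] and [(t f)^2 = t (f t f) = t t = 1]. *)
Lemma periodic_involutions f : periodic f ->
  exists s t : iet R, [/\ involution s, involution t & f = (s * t)%g].
Proof.
move=> /periodic_reflection[t [t2 ftf _]]; exists t, (t * f)%g; split=> //.
  by rewrite /involution expg2 -!mulgA (mulgA f) ftf -expg2.
by rewrite mulgA -expg2 t2 mul1g.
Qed.

End Cells.

(** * Bounded periods, and discontinuities of IETs *)

Lemma seq_argmin (R : realType) (T : eqType) (F : T -> R) (s : seq T) a :
  a \in s -> exists2 b, b \in s & {in s, forall c, F b <= F c}.
Proof.
elim: s a => // a s IH _ _; case: s IH => [_|b s IH].
  by exists a => [|c]; rewrite ?inE // => /eqP ->.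
have [c cs cmin] := IH b (mem_head b s); have [ac|/ltW ca] := leP (F a) (F c).
  exists a; rewrite ?mem_head // => d; rewrite inE => /predU1P[->//|/cmin].
  exact: le_trans.
by exists c => [|d]; rewrite inE ?cs ?orbT // => /predU1P[->|/cmin].
Qed.

Section Continuity.
Variable R : realType.
Local Notation I := (unit_itv R).
Implicit Types (f g h : iet R) (D : seq R) (x y z c : I).

Lemma itv_between x y (a : R) : val x <= a <= val y -> exists z, val z = a.
Proof.
move=> /andP[xa ay]; have a01 : 0 <= a < 1.
  have /andP[x0 _] := valP x; have /andP[_ y1] := valP y.
  by rewrite (le_trans x0 xa) (le_lt_trans ay y1).
by exists (Sub a a01).
Qed.

(** Among the points of a periodic orbit and the breaks (or 0) below them, take a pair with the
    smallest gap. A break between their iterates would give a smaller gap, so the two move in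
    parallel and the break is periodic too. Hence [N] need only be a common multiple of periods of
    the finitely many periodic breaks. *)
Lemma periodic_points_bound f : exists2 N, (0 < N)%N &
  forall x n, (0 < n)%N -> (f ^+ n)%g x = x -> (f ^+ N)%g x = x.
Proof.
have [D Df] := iet_breaks f.
pose o : I := Sub 0 (introT andP (conj (lexx 0) ltr01)).
pose L : seq I := o :: pmap insub D.
have DL c : val c \in D -> c \in L.
  by move=> cD; rewrite inE mem_pmap_sub cD orbT.
have [N N0 NL] : exists2 N, (0 < N)%N & {in L, forall d n, (0 < n)%N ->
    (f ^+ n)%g d = d -> (f ^+ N)%g d = d}.
  elim: (L) => [|d s [N N0 IH]]; first by exists 1%N.
  have [[n n0 nd]|nd] := pselect (exists2 n, (0 < n)%N & (f ^+ n)%g d = d).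
    exists (N * n)%N => [|e]; first by rewrite muln_gt0 N0.
    rewrite inE => /predU1P[-> k _ _|es k k0 /(IH e es k k0)];
      first exact: ietXM.
    by rewrite mulnC; apply: ietXM.
  exists N => // e; rewrite inE => /predU1P[-> k k0 kd|]; last exact: IH.
  by case: nd; exists k.
exists N => // x n n0 fnx.
pose s := [seq p <- [seq ((f ^+ i)%g x, d) | i <- iota 0 n, d <- L] |
  val p.2 <= val p.1].
have mem_s i d : d \in L -> val d <= val ((f ^+ i)%g x) -> ((f ^+ i)%g x,
  d) \in s.
  move=> dL di; rewrite mem_filter; apply/andP; split=> //.
  apply/allpairsP; exists ((i %% n)%N, d); split=> //;
    first by rewrite mem_iota ltn_pmod.
  by rewrite {1}(divn_eq i n) addnC ietXD ietXM.
have os : ((f ^+ 0)%g x, o) \in s.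
  by apply: mem_s; rewrite ?mem_head //; have /andP[] := valP ((f ^+ 0)%g x).
have [[y d]] := seq_argmin (fun p : I * I => val p.1 - val p.2) os.
rewrite mem_filter => /andP[dy /allpairsP[[i e] [_ eL [yE de]]]] ymin.
have {}dy : val d <= val y by [].
rewrite /= in eL yE de.
rewrite -{e}de in eL.
have fd j : val ((f ^+ j)%g y) - val ((f ^+ j)%g d) = val y - val d.
  elim: j => // j IH; rewrite !ietXS -IH; apply: Df; first by lra.
  move=> c cD; apply/negP => /andP[dc cy].
  have [z zE] := @itv_between ((f ^+ j)%g d) ((f ^+ j)%g y) c ltac:(lra).
  rewrite -zE in cD cy dc; move/DL in cD; move: cy IH;
    rewrite yE -ietXD -yE => cy.
  have : val y - val d <= val ((f ^+ (j + i))%g x) - val z by have :=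
    ymin _ (mem_s _ _ cD cy).
  by lra.
have fn : (f ^+ n)%g y = y by rewrite yE -ietXD addnC ietXD fnx.
have fnd : (f ^+ n)%g d = d by apply: val_inj; have := fd n; rewrite fn; lra.
have fNy : (f ^+ N)%g y = y.
  by apply: val_inj; have := fd N; rewrite (NL _ eL _ n0 fnd); lra.
by apply: (@iet_inj _ (f ^+ i)%g); rewrite -yE -[in RHS]fNy yE -!ietXD addnC.
Qed.

(* Since an IET is right continuous, [lcont f x] says that f is continuous at *)
(* x; it never holds at x = 0.                                                *)
Definition lcont f x := exists2 y : I, val y < val x &
  forall z, val y <= val z <= val x -> val (f x) - val (f z) = val x - val z.

Lemma lcont_comp f g x : lcont f x -> lcont g (f x) -> lcont (g * f)%g x.
Proof.
move=> [y yx fy] [w wfx gw].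
pose a := Num.max (val y) (val x - (val (f x) - val w)).
have ya : val y <= a by rewrite le_max lexx.
have wa : val x - (val (f x) - val w) <= a by rewrite le_max lexx orbT.
have ax : a < val x by rewrite gt_max yx; lra.
have [b bE] := @itv_between y x a ltac:(lra).
exists b; rewrite bE // => z /andP[az zx]; rewrite !ietME.
have fz := fy z ltac:(lra).
by rewrite gw; lra.
Qed.

Lemma lcont_inv f x : lcont f x -> lcont (f^-1)%g (f x).
Proof.
move=> [y yx fy]; have fyE := fy y ltac:(lra).
exists (f y) => [|z zE]; first by lra.
have [u uE] := @itv_between y x (val x - (val (f x) - val z)) ltac:(lra).
have fu : f u = z by apply: val_inj; have := fy u ltac:(lra); lra.
by rewrite -fu !ietK; have := fy u ltac:(lra); rewrite fu; lra.
Qed.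

Lemma lcont_preX f g n x : (forall i, (i < n)%N -> lcont f ((f ^+ i)%g x)) ->
  lcont g ((f ^+ n)%g x) -> lcont (g * f ^+ n)%g x.
Proof.
elim: n g => [|n IH] g fi gx; first by rewrite mulg1.
rewrite expgS mulgA; apply: IH => [i /ltnW/fi//|].
by apply: lcont_comp; rewrite -?ietXS; first exact: fi.
Qed.

Lemma lcont_postX f g n x : lcont g x ->
  (forall i, (i < n)%N -> lcont f ((f ^+ i)%g (g x))) ->
  lcont (f ^+ n * g)%g x.
Proof.
elim: n => [|n IH] gx fi; first by rewrite mul1g.
rewrite expgS -mulgA; apply: lcont_comp; last by rewrite ietME; apply: fi.
by apply: IH => // i /ltnW /fi.
Qed.

Lemma not_lcontX f n x : (0 < n)%N -> ~ lcont (f ^+ n)%g x ->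
  exists2 i, (i < n)%N & ~ lcont f ((f ^+ i)%g x).
Proof.
case: n => // n _ nf; apply: contrapT => nex; apply: nf.
have fi i : (i < n.+1)%N -> lcont f ((f ^+ i)%g x).
  by move=> lein; apply: contrapT => nfi; apply: nex; exists i.
by rewrite expgS; apply: lcont_preX => [i /ltnW|]; apply: fi.
Qed.

Lemma disc_finite f : exists L : seq I, forall x, ~ lcont f x -> x \in L.
Proof.
have [D Df] := iet_breaks f.
have [Z ZE] : exists Z : seq I, forall x, val x = 0 -> x \in Z.
  pose o : I := Sub 0 (introT andP (conj (lexx 0) ltr01)).
  by exists [:: o] => x x0; rewrite inE -val_eqE x0.
exists (Z ++ pmap insub D) => x nfx; rewrite mem_cat mem_pmap_sub.
apply/orP; have [xD|xD] := boolP (val x \in D); [by right|left].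
apply: ZE; apply/eqP; apply/negPn/negP => x0; apply: nfx.
have [y0 y0E] : exists y : I, val y = 0.
  by exists (Sub 0 (introT andP (conj (lexx 0) ltr01))).
have xgt0 : val y0 < val x by rewrite y0E lt_neqAle eq_sym x0;
  have /andP[] := valP x.
have [y yx yD] : exists2 y : I, val y < val x & {in D, forall c : R,
  c < val x -> c <= val y}.
  elim: (D) => [|c s [y yx IH]]; first by exists y0.
  have [yc|cy] := ltP (val y) c; last first.
    by exists y => // e; rewrite inE => /predU1P[->//|/IH].
  have [cx|xc] := ltP c (val x); last first.
    by exists y => // e; rewrite inE => /predU1P[->|/IH//]; rewrite ltNge xc.
  have [z zE] := @itv_between y x c ltac:(lra).
  exists z; rewrite zE // => e; rewrite inE => /predU1P[->//|/IH es /es].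
  by move=> /le_trans; apply; apply: ltW.
exists y => // z /andP[yz zx]; apply: Df => // c cD; apply/negP => /andP[zc].
rewrite le_eqVlt => /predU1P[cx|/(yD _ cD)]; last by lra.
by rewrite -cx cD in xD.
Qed.

Lemma breaks_disc f :
  exists2 D, breaks D f & forall x, val x \in D -> ~ lcont f x.
Proof.
have [D] := iet_breaks f.
suff H E : (forall x, val x \in E -> ~ lcont f x) -> breaks (D ++ E) f ->
    exists2 D, breaks D f & forall x, val x \in D -> ~ lcont f x.
  by rewrite -(cats0 D); apply: H.
elim: D E => [|c D IH] E nE; first by exists E.
have [[x xc fx]|nc] := pselect (exists2 x : I, val x = c & lcont f x) => DE.
  apply: (IH E nE) => u v uv uvD.
  have [/andP[uc cv]|cuv] := boolP (val u < c <= val v); last first.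
    by apply: DE => // e; rewrite inE => /predU1P[->//|/uvD].
  case: fx => y yx fy.
  pose a := Num.max (val y) (val u).
  have ya : val y <= a by rewrite le_max lexx.
  have ua : val u <= a by rewrite le_max lexx orbT.
  have ax : a < val x by rewrite gt_max yx xc.
  have [z zE] := @itv_between u x a ltac:(lra).
  have fz := fy z ltac:(lra).
  have fuz : val (f z) - val (f u) = val z - val u.
    apply: DE => [|e]; first by rewrite zE.
    rewrite inE => /predU1P[->|/uvD]; first by rewrite -xc zE; lra.
    by apply: contra; lra.
  have fxv : val (f v) - val (f x) = val v - val x.
    apply: DE => [|e]; first by rewrite xc.
    rewrite inE => /predU1P[->|/uvD]; first by rewrite -xc ltxx.
    by apply: contra; lra.
  by lra.
apply: (IH (c :: E)) => [x|u v uv uvD]; last first.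
  apply: DE => // e eD; apply: uvD; move: eD.
  by rewrite !(mem_cat, inE); case: (e == c); rewrite ?orbT.
by rewrite inE => /predU1P[xc fx|/nE//]; apply: nc; exists x.
Qed.

Lemma lcont_translation f x z : val x <= val z ->
  (forall c, val x < val c <= val z -> lcont f c) ->
  val (f z) - val (f x) = val z - val x.
Proof.
move=> xz fc; have [D Df nD] := breaks_disc f.
apply: Df => // c cD; apply/negP => /andP[xc cz].
have [w wE] := @itv_between x z c ltac:(lra).
by apply: (nD w); rewrite ?wE //; apply: fc; lra.
Qed.

Lemma last_disc f x c : val c <= val x -> ~ lcont f c -> exists d,
  [/\ val c <= val d <= val x,
    ~ lcont f d & val (f x) - val (f d) = val x - val d].
Proof.
move=> cx nc; have [L Lf] := disc_finite f.
pose s := [seq d <- L | (val d <= val x) && `[< ~ lcont f d >]].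
have cs : c \in s by rewrite mem_filter cx Lf // andbT; apply/asboolP.
have [d] := seq_argmin (fun d : I => - val d) cs.
rewrite mem_filter => /andP[/andP[dx /asboolP nd] _] dmax; exists d; split=> //.
  by have := dmax _ cs; lra.
apply: lcont_translation => // e /andP[de ex]; apply: contrapT => ne.
have es : e \in s by rewrite mem_filter ex Lf // andbT; apply/asboolP.
by have := dmax _ es; lra.
Qed.

End Continuity.

(** * Infinite orbits and the action of a reversing map on them *)

Lemma seq_bound (T : eqType) (s : seq T) (P : nat -> T -> Prop) :
  (forall m n a, (m <= n)%N -> P m a -> P n a) ->
  {in s, forall a, exists N, P N a} -> exists N, {in s, forall a, P N a}.
Proof.
move=> Pmono; elim: s => [|a s IH] sP; first by exists 0%N.
have [b bs|N HN] := IH; first by apply: sP; rewrite inE bs orbT.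
have [M HM] := sP a (mem_head a s); exists (M + N)%N => b.
rewrite inE => /predU1P[->|/HN]; first exact: Pmono (leq_addr _ _) HM.
exact: Pmono (leq_addl _ _).
Qed.

Lemma nat_pigeonhole (T : finType) (k : nat -> T) :
  exists i j, [/\ (i < j)%N, (j <= #|T|)%N & k i = k j].
Proof.
have /injectivePn[i [j ij kij]] : ~~ injectiveb (fun i : 'I_#|T|.+1 => k i).
  by apply/injectiveP => /leq_card; rewrite card_ord ltnn.
have [ltij|ltji|eqij] := ltngtP i j.
- by exists i, j; split=> //; rewrite -ltnS ltn_ord.
- by exists j, i; split=> //; rewrite -ltnS ltn_ord.
- by move: ij; rewrite -val_eqE /= eqij eqxx.
Qed.

Section Reversal.
Variable R : realType.
Local Notation I := (unit_itv R).
Implicit Types (f g h : iet R) (x y z : I).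

Lemma ietXC f m n x : (f ^+ m)%g ((f ^+ n)%g x) = (f ^+ n)%g ((f ^+ m)%g x).
Proof. by rewrite -!ietXD addnC. Qed.

Lemma ietXV_le f i m x : (i <= m)%N ->
  (f ^+ i)%g ((f ^- m)%g x) = (f ^- (m - i))%g x.
Proof.
by move=> im; apply: (@iet_inj _ (f ^+ (m - i))%g);
  rewrite -ietXD subnK // !ietVK.
Qed.

Lemma ietXV_ge f i m x : (m <= i)%N ->
  (f ^+ i)%g ((f ^- m)%g x) = (f ^+ (i - m))%g x.
Proof. by move=> im; rewrite -{1}(subnK im) ietXD ietVK. Qed.

Lemma ietVX f i m x : (i <= m)%N ->
  (f ^- m)%g ((f ^+ i)%g x) = (f ^- (m - i))%g x.
Proof.
by move=> im; apply: (@iet_inj _ (f ^+ m)%g);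
  rewrite ietVK ietXV_ge ?leq_subr ?subKn.
Qed.

Definition aperiodic f x := forall n, (0 < n)%N -> (f ^+ n)%g x <> x.

Lemma aperiodicX f x m n : aperiodic f x -> (f ^+ m)%g x = (f ^+ n)%g x ->
  m = n.
Proof.
move=> ax; wlog mn : m n / (m <= n)%N => [H mn|].
  by have [/H->|/ltnW/H->] := leqP m n.
rewrite -{1}(subnK mn) addnC ietXD => /iet_inj/esym fx.
apply/eqP; rewrite eqn_leq mn -subn_eq0 eqn0Ngt.
by apply/negP => /ax.
Qed.

Lemma aperiodic_avoid f x (L : seq I) : aperiodic f x -> exists K,
  forall i, (K <= i)%N -> (f ^+ i)%g x \notin L /\ (f ^- i)%g x \notin L.
Proof.
move=> ax; elim: L => [|y L [K HK]]; first by exists 0%N.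
have [K1 HK1] : exists K1, forall i, (K1 <= i)%N -> (f ^+ i)%g x != y.
  have [[i iy]|ny] := pselect (exists i, (f ^+ i)%g x = y); last first.
    by exists 0%N => i _; apply/eqP => iy; apply: ny; exists i.
  exists i.+1 => j ij; apply/eqP; rewrite -iy => /(aperiodicX ax) ji.
  by rewrite ji ltnn in ij.
have [K2 HK2] : exists K2, forall i, (K2 <= i)%N -> (f ^- i)%g x != y.
  have [[i iy]|ny] := pselect (exists i, (f ^- i)%g x = y); last first.
    by exists 0%N => i _; apply/eqP => iy; apply: ny; exists i.
  exists i.+1 => j ij; apply/eqP; rewrite -iy => /(congr1 (f ^+ (i + j))%g).
  rewrite !ietXV_ge ?leq_addr ?leq_addl // addKn addnK => /(aperiodicX ax) ji.
  by rewrite ji ltnn in ij.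
exists (K + K1 + K2)%N => i iK; have [|Ki1 Ki2] := HK i; first by lia.
by rewrite !inE !negb_or HK1 ?HK2 //; lia.
Qed.

(* [fund f x] says that the discontinuities of f on the orbit of x do not     *)
(* cancel each other: the jump accumulated along the whole orbit is nonzero.  *)
Definition fund f x := exists M, forall m n, (M <= m)%N -> (M <= n)%N ->
  ~ lcont (f ^+ (m + n))%g ((f ^- m)%g x).

(** Far out on the orbit, in both directions, [f] is continuous, so a single continuous stretch
    reaching that far extends to all longer ones. *)
Lemma not_fund f x : aperiodic f x -> ~ fund f x -> exists K,
  forall m n, (K <= m)%N -> (K <= n)%N -> lcont (f ^+ (m + n))%g ((f ^- m)%g x).
Proof.
move=> ax nfx; have [L Lf] := disc_finite f;
  have [K HK] := aperiodic_avoid L ax.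
have cP i : (K <= i)%N -> lcont f ((f ^+ i)%g x).
  by move=> /HK[/negP nL _]; apply: contrapT => /Lf.
have cN i : (K <= i)%N -> lcont f ((f ^- i)%g x).
  by move=> /HK[_ /negP nL]; apply: contrapT => /Lf.
have [m0 [n0 [Km0 Kn0 c0]]] : exists m n, [/\ (K <= m)%N, (K <= n)%N &
    lcont (f ^+ (m + n))%g ((f ^- m)%g x)].
  apply: contrapT => nex; apply: nfx; exists K => m n Km Kn c.
  by apply: nex; exists m, n.
exists (m0 + n0)%N => m n Km Kn.
have -> : (f ^+ (m + n) = f ^+ (n - n0) * (f ^+ (m0 + n0) * f ^+ (m - m0)))%g.
  by rewrite -!expgnDr; congr (f ^+ _)%g; lia.
have m0E : (f ^+ (m - m0))%g ((f ^- m)%g x) = (f ^- m0)%g x.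
  by rewrite ietXV_le ?leq_subr //; congr ((f ^- _)%g x); lia.
apply: lcont_postX => [|i iln].
  apply: lcont_preX => [i ilm|]; last by rewrite m0E.
  by rewrite ietXV_le; [apply: cN; lia|lia].
rewrite ietME m0E ietXV_ge; last by lia.
by rewrite addKn -ietXD; apply: cP; lia.
Qed.

(** Lying on the same orbit, expressed without negative exponents. *)
Definition orb f x y := exists m n, (f ^+ m)%g x = (f ^+ n)%g y.

Lemma orb_sym f x y : orb f x y -> orb f y x.
Proof. by move=> [m [n mn]]; exists n, m. Qed.

Lemma orb_trans f x y z : orb f x y -> orb f y z -> orb f x z.
Proof.
move=> [m [n mn]] [a [b ab]]; exists (a + m)%N, (n + b)%N.
by rewrite !ietXD mn -ab ietXC.
Qed.

Lemma fund_disc f x : fund f x -> exists2 d, ~ lcont f d & orb f x d.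
Proof.
move=> [M]; move/(_ M.+1 M.+1 (leqnSn _) (leqnSn _)).
move/(not_lcontX (ltn0Sn _)) => [i _ ni]; eexists; first exact: ni.
by exists i, M.+1; rewrite ietXC ietVK.
Qed.

Variables f h : iet R.
Hypothesis hf : (h * f * h^-1 = f^-1)%g.

Lemma revX n x : h ((f ^+ n)%g x) = (f ^- n)%g (h x).
Proof.
elim: n x => [|n IH] x; first by rewrite invg1.
by rewrite ietXSr IH expgS invgM ietME -hf !ietME ietK.
Qed.

Lemma revXV n x : h ((f ^- n)%g x) = (f ^+ n)%g (h x).
Proof. by apply: (@iet_inj _ (f ^- n)%g); rewrite ietK -revX ietVK. Qed.

Lemma aperiodic_rev x : aperiodic f x -> aperiodic f (h x).
Proof.
move=> ax n n0; rewrite -revXV => /iet_inj/(congr1 (f ^+ n)%g).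
by rewrite ietVK => /esym/ax; apply.
Qed.

(* Far out on the orbit h is continuous, so it conjugates the discontinuities *)
(* of the f ^+ (m + n) to those of their inverses.                            *)
Lemma fund_rev x : aperiodic f x -> fund f x -> fund f (h x).
Proof.
move=> ax [M HM]; have [L Lh] := disc_finite h;
  have [K HK] := aperiodic_avoid L ax.
exists (M + K)%N => m n Mm Mn; rewrite -revX => c; apply: (HM n m); try lia.
have ch : lcont h ((f ^+ m)%g x).
  by have [|/negP nL _] := HK m; [lia|apply: contrapT => /Lh].
have chV : lcont h ((f ^- n)%g x).
  by have [|_ /negP nL] := HK n; [lia|apply: contrapT => /Lh].
have fV : (f ^- (m + n))%g ((f ^+ m)%g x) = (f ^- n)%g x.
  by rewrite ietVX ?leq_addr // addKn.
have hc : (f ^+ (m + n) * h = h * f ^- (m + n))%g.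
  by apply/ietP => y; rewrite !ietME revXV.
have := lcont_comp ch c; rewrite hc => {}c.
have := lcont_inv chV; rewrite -fV -ietME => chVE.
have := lcont_comp c chVE; rewrite mulKg => /lcont_inv.
by rewrite fV invgK addnC.
Qed.

Lemma rev_eq m n x y :
  (f ^+ m)%g (h x) = (f ^+ n)%g (h y) <-> (f ^+ n)%g x = (f ^+ m)%g y.
Proof.
rewrite -!revXV; split=> [/iet_inj/(congr1 (f ^+ (m + n))%g)|mn].
  by rewrite !ietXV_ge ?leq_addr ?leq_addl // addKn addnK.
apply/(congr1 h)/(@iet_inj _ (f ^+ (m + n))%g).
by rewrite !ietXV_ge ?leq_addr ?leq_addl // addKn addnK.
Qed.

Lemma rev_evenX p n x :
  (h ^+ (p + p))%g ((f ^+ n)%g x) = (f ^+ n)%g ((h ^+ (p + p))%g x).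
Proof.
by elim: p => // p IH; rewrite addnS !addSn !ietXS IH revX revXV.
Qed.

Lemma orb_rev x y : orb f (h x) (h y) <-> orb f x y.
Proof. by split=> -[m [n]] mn; exists n, m; apply/rev_eq. Qed.

Lemma orb_revX n x y : orb f ((h ^+ n)%g x) ((h ^+ n)%g y) <-> orb f x y.
Proof. by elim: n => // n IH; rewrite !ietXS orb_rev. Qed.

(** The orbits of [d, h d, ..., h^r d] each contain one of the [r] points of [L], so two of them
    coincide and [d] returns to its orbit after at most [r] steps of [h], a number dividing [r!].
    Doubling makes the power of [h] even, so that it commutes with [f]. *)
Lemma fund_return : exists p N, (0 < p)%N /\
  forall d, ~ lcont f d -> aperiodic f d -> fund f d ->
  exists m n, [/\ (m < N)%N, (n < N)%N &
    (f ^+ m)%g d = (f ^+ n)%g ((h ^+ (p + p))%g d)].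
Proof.
have [L Lf] := disc_finite f; pose r := size L; exists r`!.
have orbL d : aperiodic f d -> fund f d -> orb f d ((h ^+ (r`! + r`!))%g d).
  move=> ad fd.
  have hd i : exists k : 'I_r, orb f ((h ^+ i)%g d) (nth d L k).
    have [ai fi] : aperiodic f ((h ^+ i)%g d) /\ fund f ((h ^+ i)%g d).
      elim: i => // i [ai fi]; rewrite ietXS; split; first exact: aperiodic_rev.
      exact: fund_rev.
    have [e /Lf eL de] := fund_disc fi.
    have ltk : (index e L < r)%N by rewrite index_mem.
    by exists (Ordinal ltk); rewrite /= nth_index.
  pose k i : 'I_r := projT1 (cid (hd i)).
  have kP i : orb f ((h ^+ i)%g d) (nth d L (k i)) by rewrite /k; case: cid.
  have [i [j [ij jr kij]]] := nat_pigeonhole k; rewrite card_ord in jr.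
  have : orb f ((h ^+ i)%g d) ((h ^+ j)%g d).
    by apply: orb_trans (kP i) _; rewrite kij; apply/orb_sym/kP.
  rewrite -(subnKC (ltnW ij)) ietXD orb_revX => od.
  have /dvdnP[q ->] : (j - i %| r`! + r`!)%N.
    by apply: dvdn_add; apply: dvdn_fact; lia.
  elim: q => [|q IH]; first by exists 0%N, 0%N.
  rewrite mulSn addnC ietXD; apply: orb_trans IH _.
  by apply/orb_revX.
have [||N HN] := @seq_bound _ L (fun N d => aperiodic f d -> fund f d ->
    exists m n, [/\ (m < N)%N, (n < N)%N &
      (f ^+ m)%g d = (f ^+ n)%g ((h ^+ (r`! + r`!))%g d)]).
- move=> N M d NM dN /dN{}dN /dN[m [n [mN nN mn]]].
  by exists m, n; rewrite (leq_trans mN) // (leq_trans nN).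
- move=> d _; have [[ad fd]|nd] := pselect (aperiodic f d /\ fund f d).
    have [m [n mn]] := orbL d ad fd; exists (m + n).+1 => _ _; exists m, n.
    by rewrite !ltnS leq_addr leq_addl.
  by exists 0%N => ad fd; case: nd.
by exists N; split=> [|d /Lf /HN //]; rewrite fact_gt0.
Qed.

End Reversal.

(** * Grids, and points far from a finite set *)

Lemma min_gap (R : realType) (D : seq R) : exists2 e, 0 < e &
  {in D &, forall a b, a < b -> e <= b - a}.
Proof.
have [e e0 emin] : exists2 e : R, 0 < e &
    {in [seq b - a | a <- D, b <- D], forall c, 0 < c -> e <= c}.
  elim: [seq _ | _ <- _, _ <- _] => [|c s [e e0 IH]]; first by exists 1.
  have [c0|c0] := ltP 0 c; last first.
    by exists e => // a; rewrite inE => /predU1P[->|/IH//]; rewrite ltNge c0.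
  exists (Num.min e c) => [|a]; first by rewrite lt_min e0.
  by rewrite inE ge_min => /predU1P[->|/IH ea /ea->//]; rewrite lexx orbT.
exists e => // a b aD bD ab; apply: emin; last by rewrite subr_gt0.
by apply/allpairsP; exists (a, b).
Qed.

Section Grid.
Variable R : realType.
Local Notation I := (unit_itv R).
Implicit Types (f g h : iet R) (D : seq R) (x y z : I).

Lemma grid (e : R) : 0 < e ->
  exists M (box : I -> 'I_M.+1) (p : 'I_M.+1 -> I), forall x,
    val (p (box x)) <= val x < val (p (box x)) + e.
Proof.
move=> e0; pose M := Num.truncn e^-1; exists M.
have M0 : 0 < M.+1%:R :> R by rewrite ltr0n.
have Me : M.+1%:R^-1 < e.
  rewrite -[ltRHS]invrK ltf_pV2 ?posrE ?invr_gt0 //.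
  by have /andP[] := truncn_itv (ltW (etrans (invr_gt0 e) e0)).
have p01 (i : 'I_M.+1) : 0 <= (i%:R / M.+1%:R : R) < 1.
  by rewrite divr_ge0 ?ler0n //= ltr_pdivrMr // mul1r ltr_nat.
pose p (i : 'I_M.+1) : I := Sub (i%:R / M.+1%:R) (p01 i).
have kP x : (Num.truncn (val x * M.+1%:R) < M.+1)%N.
  have /andP[x0 x1] := valP x; rewrite -(ltr_nat R).
  have /andP[le _] := truncn_itv (mulr_ge0 x0 (ltW M0)).
  by rewrite (le_lt_trans le) // gtr_pMl.
exists (fun x => Ordinal (kP x)), p => x; rewrite SubK /=.
have /andP[x0 x1] := valP x.
have /andP[le lt] := truncn_itv (mulr_ge0 x0 (ltW M0)).
rewrite ler_pdivrMr // le /= (@lt_trans _ _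
  ((Num.truncn (val x * M.+1%:R)).+1%:R / M.+1%:R)) //.
  by rewrite ltr_pdivlMr.
by rewrite -[X in X / _]natr1 mulrDl mul1r ltrD2l.
Qed.

Definition far (e : R) D x := {in D, forall c, e <= `|val x - c|}.

Lemma far_le (e e' : R) D x : e <= e' -> far e' D x -> far e D x.
Proof. by move=> ee' fx c /fx; apply: le_trans. Qed.

Lemma far_near (e e' : R) D x y :
  far e' D x -> `|val y - val x| <= e' - e -> far e D y.
Proof.
move=> fx yx c /fx xc; have := ler_distD (val y) (val x) c.
by rewrite (distrC (val x) (val y)); lra.
Qed.

Lemma far_same_cell (e : R) D x y :
  far e D x -> `|val y - val x| < e -> same_cell D x y.
Proof.
move=> fx yx c /fx xc; apply/idP/idP => cx; rewrite leNgt; apply/negP => cy.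
- move: xc; rewrite ger0_norm ?subr_ge0 // leNgt => /negP; apply.
  by apply: le_lt_trans yx; rewrite distrC ger0_norm; lra.
- move: xc; rewrite ltr0_norm ?subr_lt0 // leNgt => /negP; apply.
  by apply: le_lt_trans yx; rewrite ger0_norm; lra.
Qed.

(** With 0 and 1 in [D], each cell runs between two points of [D]; [w] is its midpoint and [e] half
    the smallest gap. *)
Lemma far_exists D : 0 \in D -> 1 \in D -> exists2 e, 0 < e &
  forall x, exists2 w, same_cell D x w & far e D w.
Proof.
move=> D0 D1; have [e e0 gap] := min_gap D; exists (e / 2) => [|x];
  first by lra.
have /andP[x0 x1] := valP x.
have [|a] := @seq_argmin R _ (fun a => - a) [seq a <- D | a <= val x] 0.
  by rewrite mem_filter x0.
rewrite mem_filter => /andP[ax aD] amax.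
have [|b] := @seq_argmin R _ id [seq b <- D | val x < b] 1.
  by rewrite mem_filter x1.
rewrite mem_filter => /andP[xb bD] bmin.
have ab := gap _ _ aD bD ltac:(lra).
have aP c : c \in D -> c <= val x -> c <= a.
  by move=> cD cx; have := amax c; rewrite mem_filter cx cD lerN2; apply.
have bP c : c \in D -> val x < c -> b <= c.
  by move=> cD cx; have := bmin c; rewrite mem_filter cx cD; apply.
have a0 := aP _ D0 x0; have b1 := bP _ D1 x1.
have w01 : 0 <= (a + b) / 2 < 1 by lra.
pose w : I := Sub ((a + b) / 2) w01.
have wE : val w = (a + b) / 2 by [].
clearbody w; exists w => c cD.
  have [/(aP _ cD) ca|/(bP _ cD) cb] := leP c (val x); rewrite wE.
    by apply/esym; lra.
  by apply/esym/negbTE; rewrite -ltNge; lra.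
have [/(aP _ cD) ca|/(bP _ cD) cb] := leP c (val x); rewrite wE.
  by rewrite ger0_norm; lra.
by rewrite ler0_norm; lra.
Qed.

Definition pull (k : iet R) D := [seq val ((k^-1)%g s) | s <- pmap insub D].

Lemma pullP (k : iet R) D z : val (k z) \in D -> val z \in pull k D.
Proof.
by move=> kz; apply/mapP; exists (k z); rewrite ?ietK // mem_pmap_sub.
Qed.

(** As [k] is a translation on cells of [F], a point of [D] separating the images would have a
    preimage in [F] separating the points. *)
Lemma pull_cell (k : iet R) D E F x y : breaks E k ->
  {subset E <= F} -> {subset pull k D <= F} ->
  same_cell F x y -> same_cell D (k x) (k y).
Proof.
move=> Ek EF pF; suff H u v :
    same_cell F u v -> {in D, forall s, s <= val (k v) -> s <= val (k u)}.
  by move=> xy s sD; apply/idP/idP; apply: H => //; apply: same_cell_sym.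
move=> uv s sD sv; rewrite leNgt; apply/negP => us.
have kuv := breaks_cell Ek (same_cell_sub EF uv).
have [z zE] := @itv_between _ u v (val u + (s - val (k u))) ltac:(lra).
have uz : same_cell F u z.
  move=> c /uv cuv; apply/idP/idP => [|cz]; first by lra.
  by rewrite cuv; lra.
have kz := breaks_cell Ek (same_cell_sub EF uz).
have zF : val z \in F.
  by apply/pF/pullP; rewrite (_ : val (k z) = s) //; lra.
by have := uz _ zF; rewrite lexx zE; lra.
Qed.

(** A point of [D] within [e] of [k x] would pull back to a point of [F] within [e] of [x]; having 0
    and 1 in [F] keeps that point in the unit interval. *)
Lemma pull_far (e : R) (k : iet R) D E F x : breaks E k ->
  {subset E <= F} -> {subset pull k D <= F} -> 0 \in F -> 1 \in F ->
  far e F x -> far e D (k x).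
Proof.
move=> Ek EF pF F0 F1 fx s sD; rewrite leNgt; apply/negP => ks.
have /andP[x0 x1] := valP x.
have := fx _ F0; have := fx _ F1.
rewrite subr0 (ger0_norm x0) ler0_norm; last by lra.
move=> xe1 xe0; move: ks; rewrite ltr_norml => ks.
have z01 : 0 <= val x + (s - val (k x)) < 1 by lra.
pose z : I := Sub (val x + (s - val (k x))) z01;
  have zE : val z = val x + (s - val (k x)) by [].
clearbody z; have zx : `|val z - val x| < e by rewrite ltr_norml; lra.
have kz := breaks_cell Ek (same_cell_sub EF (far_same_cell fx zx)).
have : val z \in F.
  by apply/pF/pullP; rewrite (_ : val (k z) = s) //; lra.
by move=> /fx; rewrite distrC leNgt zx.
Qed.

End Grid.

(** * Powers of [f] close to the identity, and the sign of the displacement *)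

Section RecurrentPart.
Variables (R : realType) (f h : iet R).
Local Notation I := (unit_itv R).
Hypothesis hf : (h * f * h^-1 = f^-1)%g.
Variable Z : I -> Prop.
Hypothesis sZ : simple Z.
Hypothesis Zf : forall x, Z (f x) <-> Z x.
Hypothesis Zh : forall x, Z (h x) <-> Z x.
Hypothesis Za : forall x, Z x -> aperiodic f x.
Hypothesis Znf : forall x, Z x -> ~ lcont f x -> ~ fund f x.
Implicit Types (x y z : I) (D : seq R) (S : seq I).

Lemma ZfX n x : Z ((f ^+ n)%g x) <-> Z x.
Proof. by elim: n => // n IH; rewrite ietXS Zf. Qed.

Lemma ZfXV n x : Z ((f ^- n)%g x) <-> Z x.
Proof. by rewrite -(ZfX n) ietVK. Qed.

(** Some [d = f^i x] is a discontinuity of [f]. If it were at least [K] steps from both ends of the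
    segment, [not_fund] would make [f^n] continuous at [x]; so [x] or [f^n x] is fewer than [K]
    steps from [d]. *)
Lemma disc_powers : exists S, forall x n, Z x -> (0 < n)%N ->
  ~ lcont (f ^+ n)%g x -> x \in S \/ (f ^+ n)%g x \in S.
Proof.
have [L Lf] := disc_finite f.
have [||K HK] := @seq_bound _ L (fun K d => Z d -> ~ lcont f d ->
    forall m n, (K <= m)%N -> (K <= n)%N ->
      lcont (f ^+ (m + n))%g ((f ^- m)%g d)).
- by move=> N M d NM dN Zd nd m n mM nM; apply: dN => //; apply: leq_trans NM _.
- move=> d _; have [[Zd nd]|H] := pselect (Z d /\ ~ lcont f d).
    by have [K HK] := not_fund (Za Zd) (Znf Zd nd); exists K => _ _.
  by exists 0%N => Zd nd; case: H.
exists ([seq (f ^- i)%g d | d <- L, i <- iota 0 K] ++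
        [seq (f ^+ i)%g d | d <- L, i <- iota 0 K]) => x n Zx n0 nx.
have [i lein nd] := not_lcontX n0 nx; pose d := (f ^+ i)%g x; rewrite -/d in nd.
have xE : x = (f ^- i)%g d by rewrite /d ietK.
have fxE : (f ^+ n)%g x = (f ^+ (n - i))%g d.
  by rewrite -ietXD subnK // ltnW.
have Zd : Z d by apply/ZfX.
clearbody d; have [iK|Ki] := ltnP i K.
  left; rewrite mem_cat; apply/orP; left; apply/allpairsP.
  by exists (d, i); rewrite mem_iota Lf.
have [jK|Kj] := ltnP (n - i) K.
  right; rewrite mem_cat; apply/orP; right; apply/allpairsP.
  by exists (d, (n - i)%N); rewrite mem_iota Lf.
case: nx; rewrite xE -(subnKC (ltnW lein)).
by apply: HK => //; exact: Lf.
Qed.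

Lemma disc_set : exists S,
  (forall x y, val x <= val y ->
    (forall s : I, s \in S -> ~~ (val x < val s <= val y)) ->
    (Z x <-> Z y)) /\
  (forall x n, Z x -> (0 < n)%N -> ~ lcont (f ^+ n)%g x ->
    x \in S \/ (f ^+ n)%g x \in S).
Proof.
have [S HS] := disc_powers; have [D ZD] := sZ.
exists (S ++ pmap insub D); split=> [x y xy Dxy|x n Zx n0 /(HS _ _ Zx n0)].
  have cxy : same_cell D x y.
    move=> c cD; apply/idP/idP => [cx|cy]; first exact: le_trans cx xy.
    rewrite leNgt; apply/negP => xc.
    have [z zE] := @itv_between _ x y c ltac:(lra).
    have := Dxy z; rewrite mem_cat mem_pmap_sub zE cD orbT xc cy.
    by move/(_ isT).
  by split; apply: ZD => //; apply: same_cell_sym.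
by rewrite !mem_cat => -[->|->]; [left|right].
Qed.

Variable S : seq I.
Hypothesis SZ : forall x y, val x <= val y ->
  (forall s : I, s \in S -> ~~ (val x < val s <= val y)) -> (Z x <-> Z y).
Hypothesis SP : forall x n, Z x -> (0 < n)%N -> ~ lcont (f ^+ n)%g x ->
    x \in S \/ (f ^+ n)%g x \in S.

(* Two powers of f that agree up to e on a grid agree up to e off short       *)
(* intervals to the right of their discontinuities.                           *)
Lemma near_identity (e : R) : 0 < e -> exists2 n, (0 < n)%N & exists2 T : seq I,
  size T = (3 * size S)%N & forall y, Z y ->
  (forall t : I, t \in T -> ~~ (val t <= val y < val t + e)) ->
  `|val ((f ^+ n)%g y) - val y| < e.
Proof.
move=> e0; have [M [box [p pP]]] := grid e0.
(* The exponent is shifted by one because [SP] speaks of positive powers. *)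
pose k n := [ffun j : 'I_M.+1 => box ((f ^+ n.+1)%g (p j))].
have [n1 [n2 [n12 _ kE]]] := nat_pigeonhole k.
exists (n2 - n1)%N; first by rewrite subn_gt0.
(* [L] contains the points of [Z] where either power is discontinuous, and those where [Z] may begin
   or end. *)
pose L := S ++ [seq (f ^- n1.+1)%g s | s <- S] ++
  [seq (f ^- n2.+1)%g s | s <- S].
exists [seq (f ^+ n1.+1)%g l | l <- L].
  by rewrite size_map !size_cat !size_map; lia.
move=> y Zy yT; pose x := (f ^- n1.+1)%g y.
have yE : y = (f ^+ n1.+1)%g x by rewrite /x ietVK.
have Zx : Z x by apply/ZfXV.
have gyE : (f ^+ (n2 - n1))%g y = (f ^+ n2.+1)%g x.
  by rewrite yE -ietXD; congr ((f ^+ _)%g x); lia.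
clearbody x; have cut z n : (n == n1.+1) || (n == n2.+1) -> val z <= val x ->
    (forall l : I, l \in L -> ~~ (val z < val l <= val x)) ->
    val ((f ^+ n)%g x) - val ((f ^+ n)%g z) = val x - val z.
  move=> nE zx zL; apply: lcont_translation => // c /andP[zc cx].
  apply: contrapT => nc.
  have Zc : Z c.
    apply/(SZ cx) => // s sS; have /zL : s \in L by rewrite mem_cat sS.
    by apply: contra; lra.
  have n0 : (0 < n)%N by case/orP: nE => /eqP->.
  have cL : c \in L.
    have [cS|fcS] := SP Zc n0 nc; first by rewrite mem_cat cS.
    rewrite !mem_cat; apply/orP; right; apply/orP.
    by case/orP: nE => /eqP nE; [left|right]; apply/mapP;
      exists ((f ^+ n)%g c); rewrite // nE ietK.
  by have := zL c cL; rewrite zc cx.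
have /andP[px xp] := pP x.
have [[l lL /andP[pl lx]]|noL] :=
    pselect (exists2 l : I, l \in L & val (p (box x)) < val l <= val x).
  have ls : l \in [seq l <- L | val l <= val x] by rewrite mem_filter lx.
  (* The last point [m] of [L] up to [x] is within [e] of [x] and moves in parallel with it, which
     puts [y] in an excluded interval. *)
  have [m] := seq_argmin (fun l : I => - val l) ls.
  rewrite mem_filter => /andP[mx mL] mmax.
  have := cut m n1.+1; rewrite eqxx => /(_ isT mx) mE.
  have {}mE : val ((f ^+ n1.+1)%g x) - val ((f ^+ n1.+1)%g m) = val x - val m.
    apply: mE => l' l'L; apply/negP => /andP[ml l'x].
    by have := mmax l'; rewrite mem_filter l'x l'L => /(_ isT); lra.
  have lm := mmax _ ls.
  have /yT : (f ^+ n1.+1)%g m \in [seq (f ^+ n1.+1)%g l | l <- L].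
    by apply: map_f.
  by rewrite yE; lra.
have noL' l : l \in L -> ~~ (val (p (box x)) < val l <= val x).
  by move=> lL; apply/negP => lP; apply: noL; exists l.
have := cut _ n1.+1 _ px noL'; rewrite eqxx => /(_ isT) E1.
have := cut _ n2.+1 _ px noL'; rewrite eqxx orbT => /(_ isT) E2.
(* Under both powers [x] moves in parallel with its grid point, whose two images share a box. *)
have /ffunP /(_ (box x)) := kE; rewrite !ffunE => bE.
have := pP ((f ^+ n1.+1)%g (p (box x)));
  have := pP ((f ^+ n2.+1)%g (p (box x))).
rewrite -bE gyE yE ltr_norml; lra.
Qed.

Section Sign.
Variables (eta e : R) (n : nat) (T : seq I).
Hypothesis e0 : 0 < e.
Hypothesis n0 : (0 < n)%N.
Hypothesis eT : (size T).+2%:R * e <= eta.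
Hypothesis gT : forall y, Z y ->
  (forall t : I, t \in T -> ~~ (val t <= val y < val t + e)) ->
  `|val ((f ^+ n)%g y) - val y| < e.

Lemma eta_gt : e < eta.
Proof. by apply: lt_le_trans eT; rewrite ltr_pMl // ltr1n. Qed.

(** Each point of [T] excludes at most one of the [(size T).+1] points [y + i e], so [f^n] moves one
    of them, [z], by less than [e]. The last discontinuity [d] of [f^n] between [y] and [z] would
    move in parallel with [z], so both [d] and [f^n d] would lie in the stretch free of [S], against
    [SP]. Hence [f^n] is a translation from [y] to [z]. *)
Lemma middle y : Z y -> val y + eta <= 1 ->
  (forall s : I, s \in S -> ~~ (val y - e < val s < val y + eta)) ->
  lcont (f ^+ n)%g y /\ `|val ((f ^+ n)%g y) - val y| < e.
Proof.
move=> Zy y1 yS.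
have e_gt0 := e0; have /andP[y0 _] := valP y.
have pe (i : nat) : (i <= size T)%N -> i%:R * e <= eta - e - e.
  move=> iT; have : i%:R * e <= (size T)%:R * e by rewrite ler_pM2r // ler_nat.
  by move: eT; rewrite -(addn2 (size T)) natrD mulrDl; lra.
have pt (i : nat) : (i <= size T)%N -> exists z, val z = val y + i%:R * e.
  move=> iT; have i0 : 0 <= i%:R * e by rewrite mulr_ge0 ?ler0n // ltW.
  have z01 : 0 <= val y + i%:R * e < 1 by have := pe i iT; lra.
  by exists (Sub (val y + i%:R * e) z01).
have [z [yz zy zT]] : exists z, [/\ val y <= val z,
  val z <= val y + (eta - e - e) &
    forall t : I, t \in T -> ~~ (val t <= val z < val t + e)].
  apply: contrapT => nz.
  have bad (i : 'I_(size T).+1) : exists k : 'I_(size T),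
      val (tnth (in_tuple T) k) <= val y + i%:R * e
        < val (tnth (in_tuple T) k) + e.
    have iT : (i <= size T)%N by rewrite -ltnS.
    have [z zE] := pt i iT; apply: contrapT => nk; apply: nz; exists z; split.
    - by rewrite zE lerDl mulr_ge0 ?ler0n // ltW.
    - by rewrite zE lerD2l pe.
    move=> t tT; apply/negP => tz; apply: nk; rewrite -zE.
    have /tnthP[k kE] : t \in in_tuple T by [].
    by exists k; rewrite -kE.
  pose k i := projT1 (cid (bad i)).
  have kP (i : 'I_(size T).+1) :
      val (tnth (in_tuple T) (k i)) <= val y + i%:R * e
        < val (tnth (in_tuple T) (k i)) + e.
    by rewrite /k; case: cid.
  have /injectivePn[i [j ij kij]] : ~~ injectiveb k.
    by apply/injectiveP => /leq_card; rewrite !card_ord ltnn.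
  have key (i' j' : 'I_(size T).+1) : k i' = k j' -> (i' < j')%N -> False.
    move=> kE ltij; have := kP i'; have := kP j'; rewrite kE.
    have : i'.+1%:R * e <= j'%:R * e by rewrite ler_pM2r // ler_nat.
    by rewrite -natr1 mulrDl mul1r; lra.
  have [ltij|ltji|eqij] := ltngtP i j; [exact: key ltij|by apply: key ltji|].
  by move: ij; rewrite -val_eqE /= eqij eqxx.
have Zc c : val y <= val c <= val z -> Z c.
  move=> cz; apply/(SZ (x := y)) => //; first by lra.
  by move=> s sS; apply: contra (yS s sS); lra.
have gz : `|val ((f ^+ n)%g z) - val z| < e by apply: gT => //; apply: Zc; lra.
have gc c : val y <= val c <= val z -> lcont (f ^+ n)%g c.
  move=> cz; apply: contrapT => nc.
  have [d [dcz nd dE]] := last_disc (proj2 (andP cz)) nc.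
  have Zd : Z d by apply: Zc; lra.
  move: gz; rewrite ltr_norml => gz.
  have [/yS|/yS] := SP Zd n0 nd; first by apply/negP; lra.
  by apply/negP; lra.
split; first by apply: gc; lra.
have <- : val ((f ^+ n)%g z) - val z = val ((f ^+ n)%g y) - val y; last by [].
suff : val ((f ^+ n)%g z) - val ((f ^+ n)%g y) = val z - val y by lra.
by apply: lcont_translation => // c cyz; apply: gc; lra.
Qed.

Definition marks : seq R := 0 :: 1 :: [seq val s | s <- S].

(** All points between [y] and [y'] satisfy the assumptions of [middle], so [f^n] is continuous
    there. *)
Lemma far_shift y y' : same_cell marks y y' -> far eta marks y ->
  far eta marks y' ->
  Z y -> val ((f ^+ n)%g y') - val y' = val ((f ^+ n)%g y) - val y.
Proof.
move=> yy' fy fy' Zy; wlog le : y y' yy' fy fy' Zy / val y <= val y' => [H|].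
  have [|/ltW y'y] := leP (val y) (val y'); first exact: H.
  apply/esym/H => //; first exact: same_cell_sym.
  apply/(SZ y'y) => // s sS; have : val s \in marks by rewrite !inE map_f ?orbT.
  by move=> /yy' syy'; apply/negP; rewrite syy' => /andP[]; lra.
have ms s : s \in S -> val s \in marks by move=> sS; rewrite !inE map_f ?orbT.
have e_gt0 := e0; have eg := eta_gt.
have gap s : s \in S -> ~~ (val y - e < val s < val y' + eta).
  move=> /ms sm; apply/negP => /andP[ys sy].
  have := yy' _ sm; have [sy1|sy1] := leP (val s) (val y).
    by have := fy _ sm; rewrite ger0_norm; lra.
  move=> /esym/negbT; rewrite -ltNge => y's.
  by have := fy' _ sm; rewrite ltr0_norm; lra.
have y'1 : val y' + eta <= 1.
  have := fy' 1; rewrite !inE eqxx orbT => /(_ isT).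
  have /andP[_ lt1] := valP y'.
  by rewrite ltr0_norm; lra.
suff : val ((f ^+ n)%g y') - val ((f ^+ n)%g y) = val y' - val y by lra.
apply: lcont_translation => // c cy.
have Zc : Z c.
  apply/(SZ (x := y)) => //; first by lra.
  by move=> s sS; apply: contra (gap s sS); lra.
have [] // := @middle c Zc ltac:(lra).
by move=> s sS; apply: contra (gap s sS); lra.
Qed.

Lemma far_small y : far eta marks y -> Z y -> `|val ((f ^+ n)%g y) - val y| < e.
Proof.
move=> fy Zy; have e_gt0 := e0; have eg := eta_gt; have /andP[y0 y1] := valP y.
have [] // := @middle y Zy.
  have := fy 1; rewrite !inE eqxx orbT => /(_ isT).
  by rewrite ltr0_norm; lra.
move=> s sS; have := fy (val s); rewrite !inE map_f ?orbT // => /(_ isT).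
move=> ys; apply/negP => sy; move: ys; rewrite leNgt => /negP; apply.
by rewrite ltr_norml; lra.
Qed.

(** The direction is read at a far point because near the marks [f^n] need not be close to the
    identity; by [far_shift] any far point of the cell gives the same answer. *)
Definition rising x := Z x /\
  exists y, [/\ same_cell marks x y, far eta marks y &
    val y < val ((f ^+ n)%g y)].

Lemma marks_Z x y : same_cell marks x y -> Z x -> Z y.
Proof.
wlog xy : x y / val x <= val y => [H xyS|xyS Zx].
  have [|/ltW yx] := leP (val x) (val y) => [/H|]; first exact.
  suff : Z y <-> Z x by tauto.
  apply: SZ => // s sS; apply/negP; rewrite xyS;
    last by rewrite !inE map_f ?orbT.
  by move=> /andP[]; lra.
apply/(SZ xy) => // s sS; apply/negP; rewrite -xyS;
  last by rewrite !inE map_f ?orbT.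
by move=> /andP[]; lra.
Qed.

Lemma simple_rising : simple rising.
Proof.
exists marks => x y xy [Zx [w [xw fw gw]]]; split; first exact: marks_Z Zx.
by exists w; split=> //; apply: same_cell_trans (same_cell_sym xy) xw.
Qed.

Lemma risingE x w : Z x -> same_cell marks x w -> far eta marks w ->
  rising x <-> val w < val ((f ^+ n)%g w).
Proof.
move=> Zx xw fw; split=> [[_ [y [xy fy gy]]]|gw]; last by split=> //; exists w.
have := far_shift (same_cell_trans (same_cell_sym xy) xw) fy fw (marks_Z xy Zx).
by lra.
Qed.

Variables (D E F : seq R).
Hypotheses (fD : breaks D f) (hE : breaks E h).
Hypotheses (mF : {subset marks <= F}) (DF : {subset D <= F}).
Hypothesis EF : {subset E <= F}.
Hypothesis pfF : {subset pull f marks <= F}.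
Hypothesis phF : {subset pull h marks <= F}.
Hypothesis farF : forall x, exists2 w, same_cell F x w & far (eta + eta) F w.

(** The margin [eta + eta] keeps [f^n w] in the [F]-cell of [w], where [f] and [h] are translations,
    and leaves [eta] to spare after a move of less than [e]. *)
Lemma farF_shift x : Z x -> exists w, [/\ same_cell marks x w,
  far eta marks w, Z w,
  `|val ((f ^+ n)%g w) - val w| < e &
  [/\ same_cell F x w, same_cell F w ((f ^+ n)%g w) & far (eta + eta) F w]].
Proof.
move=> Zx; have [w xw fw] := farF x; have e_gt0 := e0; have eg := eta_gt;
  exists w.
have xwm := same_cell_sub mF xw.
have fwm : far eta marks w by apply: (@far_le _ _ (eta + eta)) =>
  [|c /mF /fw //]; lra.
have Zw := marks_Z xwm Zx; have gw := far_small fwm Zw.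
by split=> //; split=> //; apply: far_same_cell fw _; lra.
Qed.

Lemma F01 : 0 \in F /\ 1 \in F.
Proof. by split; apply: mF; rewrite !inE eqxx ?orbT. Qed.

Lemma rising_f x : Z x -> rising (f x) <-> rising x.
Proof.
move=> Zx; have [w [xw fw Zw gw [xwF wgw fwF]]] := farF_shift Zx.
have e_gt0 := e0; have eg := eta_gt; have [F0 F1] := F01.
rewrite (risingE Zx xw fw) (@risingE _ (f w)); last 1 first.
- apply: (@far_le _ _ (eta + eta)); first by lra.
  exact: (pull_far fD DF pfF F0 F1 fwF).
- by rewrite -ietXSr ietXS; have := breaks_cell fD (same_cell_sub DF wgw);
  split; lra.
- exact/Zf.
- exact: (pull_cell fD DF pfF xwF).
Qed.

(** At [u = h (f^n w)] one has [f^n u = h w]. As [h] moves [w] and [f^n w] in parallel, the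
    displacement at [u] is opposite to that at [w], and it is nonzero by aperiodicity. *)
Lemma rising_h x : Z x -> rising (h x) <-> ~ rising x.
Proof.
move=> Zx; have [w [xw fw Zw gw [xwF wgw fwF]]] := farF_shift Zx.
have e_gt0 := e0; have eg := eta_gt; have [F0 F1] := F01.
pose u := h ((f ^+ n)%g w).
have uE := breaks_cell hE (same_cell_sub EF wgw); rewrite -/u in uE.
have gu : (f ^+ n)%g u = h w by rewrite /u -(revXV hf) ietK.
have fhw := pull_far hE EF phF F0 F1 fwF.
rewrite (risingE Zx xw fw) (@risingE _ u); last 1 first.
- by apply: far_near fhw _; rewrite uE; lra.
- have wne : val ((f ^+ n)%g w) <> val w by move=> /val_inj; apply: Za.
  by rewrite gu; split=> [|/negP]; lra.
- exact/Zh.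
- apply: same_cell_trans (pull_cell hE EF phF xwF) _.
  by apply: far_same_cell fhw _; rewrite uE; lra.
Qed.

End Sign.
End RecurrentPart.

Lemma sign_set (R : realType) (f h : iet R) (Z : unit_itv R -> Prop) :
  (h * f * h^-1 = f^-1)%g -> simple Z ->
  (forall x, Z (f x) <-> Z x) -> (forall x, Z (h x) <-> Z x) ->
  (forall x, Z x -> aperiodic f x) ->
  (forall x, Z x -> ~ lcont f x -> ~ fund f x) ->
  exists B, [/\ simple B, forall x, Z x -> (B (f x) <-> B x)
              & forall x, Z x -> (B (h x) <-> ~ B x)].
Proof.
move=> hf sZ Zf Zh Za Znf; have [S [SZ SP]] := disc_set sZ Zf Za Znf.
have [D fD] := iet_breaks f; have [E hE] := iet_breaks h; pose M := marks S.
pose F := M ++ D ++ E ++ pull f M ++ pull h M.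
have [||eta' eta0 farF] := @far_exists R F;
  try by rewrite mem_cat !inE eqxx ?orbT.
pose eta := eta' / 2; pose e := eta / (3 * size S).+2%:R.
have e0 : 0 < e by rewrite divr_gt0 ?ltr0n // divr_gt0.
have [n n0 [T sT gT]] := near_identity Zf SZ SP e0.
have eT : (size T).+2%:R * e <= eta by rewrite sT mulrC divfK // pnatr_eq0.
have {}farF x : exists2 w, same_cell F x w & far (eta + eta) F w.
  by have [w xw fw] := farF x; exists w => //; rewrite -splitr.
have sub : [/\ {subset M <= F}, {subset D <= F}, {subset E <= F},
    {subset pull f M <= F} & {subset pull h M <= F}].
  by split=> c cP; rewrite !mem_cat cP ?orbT.
case: sub => mF DF EF pfF phF.
exists (rising f Z S eta n); split.
- exact: simple_rising.
- by move=> x; apply: (rising_f Zf SZ SP e0 n0 eT gT fD mF DF pfF farF).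
- by move=> x; apply: (rising_h hf Zh Za SZ SP e0 n0 eT gT hE mF EF phF farF).
Qed.

(** * Gluing a periodic reverser *)

Section Assembly.
Variable R : realType.
Local Notation I := (unit_itv R).
Implicit Types (f g h : iet R) (x y : I).

Lemma reversed_by_periodic f g : (f * g * f = g)%g -> periodic g ->
  periodic (f * g)%g.
Proof.
move=> fgf [n n0 gn]; exists (2 * n)%N; first by rewrite muln_gt0.
by rewrite expgnA expg2 mulgA fgf -expg2 -expgnA mulnC expgnA gn expg1n.
Qed.

Lemma periodicV f : periodic f -> periodic (f^-1)%g.
Proof. by move=> [n n0 fn]; exists n; rewrite // expVgn fn invg1. Qed.

Variables f h : iet R.
Hypothesis hf : (h * f * h^-1 = f^-1)%g.

(** Here [g] is a reflection on [P], [h] on the rest of [A] and [h^-1] elsewhere. Off [P] and [E0],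
    [h] swaps [A] with its complement, so [g] squares to the identity there, as it does on [P]; on
    the rest of [E0], [g] is [h], whose [q]-th power is trivial. As [q] is even, [g^q = 1]. *)
Lemma periodic_reverser : exists2 g, (f * g * f = g)%g & periodic g.
Proof.
have [N N0 fN] := periodic_points_bound f.
have [p [M [p0 fundM]]] := fund_return hf.
pose q := (p + p)%N.
pose P x := (f ^+ N)%g x = x.
pose E0 x := (h ^+ q)%g x = x.
(* The equation says [h^q x = f^(i - j) x]; bounding [i] and [j] keeps the set simple. *)
pose E (c : nat -> nat -> bool) x := exists2 i, (i < M)%N &
  exists2 j, (j < M)%N & c i j /\ (f ^+ i)%g x = (f ^+ j)%g ((h ^+ q)%g x).
pose gtE := E (fun i j => (j < i)%N); pose ltE := E (fun i j => (i < j)%N).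
have hqf n x : (h ^+ q)%g ((f ^+ n)%g x) = (f ^+ n)%g ((h ^+ q)%g x).
  exact: rev_evenX.
have sE c : simple (E c).
  apply: simple_ex_lt => i; apply: simple_ex_lt => j; apply: simple_and.
    by exists [::].
  exact: (simple_eq (f ^+ i)%g (f ^+ j * h ^+ q)%g).
have sP : simple P by exact: (simple_eq (f ^+ N)%g 1%g).
have sE0 : simple E0 by exact: (simple_eq (h ^+ q)%g 1%g).
have Pf x : P (f x) <-> P x.
  by rewrite /P -ietXSr ietXS; split=> [/iet_inj|->].
have Ph x : P (h x) <-> P x.
  by split; [move/(@rev_eq _ _ _ hf N 0)|move=> Px;
    apply/(@rev_eq _ _ _ hf N 0)].
have E0f x : E0 (f x) <-> E0 x.
  by rewrite /E0 (hqf 1%N); split=> [/iet_inj|->].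
have E0h x : E0 (h x) <-> E0 x.
  by rewrite /E0 -ietXSr ietXS; split=> [/iet_inj|->].
have Ef c x : E c (f x) <-> E c x.
  split=> -[i iM [j jM [cij ij]]]; exists i => //; exists j => //; split=> //.
    move: ij; rewrite (hqf 1%N) -ietXSr ietXS -[(f ^+ 1)%g _]/(f _).
    by rewrite -ietXSr ietXS => /iet_inj.
  by rewrite (hqf 1%N) -ietXSr ietXS ij -ietXS ietXSr.
have Eh c x : E c (h x) <-> E (fun i j => c j i) x.
  have hq y : (h ^+ q)%g (h y) = h ((h ^+ q)%g y) by rewrite -ietXSr ietXS.
  split=> -[i iM [j jM [cij ij]]]; exists j => //; exists i => //; split=> //.
    by move: ij; rewrite hq => /(rev_eq hf).
  by rewrite hq; apply/(rev_eq hf).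
have gtEh x : gtE (h x) <-> ltE x by exact: Eh.
have ltEh x : ltE (h x) <-> gtE x by exact: Eh.
have aP x : ~ P x -> aperiodic f x by move=> nP n n0 /(fN _ _ n0)/nP.
(* On an infinite orbit the exponent is unique, so it has only one sign. *)
have gt_lt x : ~ P x -> gtE x -> ltE x -> False.
  move=> /aP ax [i _ [j _ [ji ij]]] [k _ [l _ [kl klE]]].
  suff /(aperiodicX ax) : (f ^+ (l + i))%g x = (f ^+ (j + k))%g x by lia.
  by rewrite !ietXD ij klE ietXC.
pose Z x := [/\ ~ P x, ~ E0 x, ~ gtE x & ~ ltE x].
have sZ : simple Z.
  have [D HD] := simple_and (simple_and (simple_not sP) (simple_not sE0))
    (simple_and
      (simple_not (sE _ : simple gtE)) (simple_not (sE _ : simple ltE))).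
  by exists D => x y /HD xy [nP nE0 ngt nlt]; have [//|[? ?] [? ?]] := xy.
have Zf x : Z (f x) <-> Z x.
  have := (Pf x, E0f x, Ef (fun i j => (j < i)%N) x,
    Ef (fun i j => (i < j)%N) x).
  by rewrite -/gtE -/ltE; move=> [[[[? ?] [? ?]] [? ?]] [? ?]];
    split=> -[? ? ? ?]; split; tauto.
have Zh x : Z (h x) <-> Z x.
  have := (Ph x, E0h x, gtEh x, ltEh x).
  by move=> [[[[? ?] [? ?]] [? ?]] [? ?]]; split=> -[? ? ? ?]; split; tauto.
have Za x : Z x -> aperiodic f x by move=> [/aP].
have Znf x : Z x -> ~ lcont f x -> ~ fund f x.
  move=> Zx; have [nP nE0 ngt nlt] := Zx; move=> nx fx.
  have [i [j [iM jM ij]]] := fundM x nx (Za _ Zx) fx.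
  have [ltij|ltji|eqij] := ltngtP i j.
  - by apply: nlt; exists i => //; exists j.
  - by apply: ngt; exists i => //; exists j.
  - by apply: nE0; move: ij; rewrite eqij => /iet_inj/esym.
have [B [sB Bf Bh]] := sign_set hf sZ Zf Zh Za Znf.
pose A x := E0 x \/ (gtE x \/ (Z x /\ B x)).
have sA : simple A.
  by apply: simple_or => //; apply: simple_or; [exact: sE|exact: simple_and].
have Af x : A (f x) <-> A x.
  have := (E0f x, Ef (fun i j => (j < i)%N) x, Zf x).
  rewrite -/gtE => -[[? ?] ?].
  have [Zx|nZx] := pselect (Z x); last by rewrite /A; tauto.
  by have := Bf x Zx; rewrite /A; tauto.
have Ah x : ~ P x -> ~ E0 x -> (A (h x) <-> ~ A x).
  move=> nP nE0; have := (E0h x, gtEh x, Zh x, gt_lt x nP) => -[[[? ?] ?] ?].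
  have [Zx|nZx] := pselect (Z x).
    have [_ _ ngt nlt] := Zx; have := Bh x Zx; rewrite /A; tauto.
  have : gtE x \/ ltE x.
    by apply: contrapT => nE; apply: nZx; split=> // nx; apply: nE;
      [left|right].
  by rewrite /A; tauto.
(* Being trivial off [P], this map is periodic, so [periodic_reflection] applies to it. *)
pose u x := if `[<P x>] then f x else x.
have uP x : P x -> u x = f x by move=> Px; rewrite /u (asboolT Px).
have unP x : ~ P x -> u x = x by move=> Px; rewrite /u (asboolF Px).
have [f' f'E] : exists f' : iet R, f' =1 u.
  apply: (@iet_of_iter _ _ N.-1); first exact: pt_if (iet_pt f) (pt_id R).
  move=> x; rewrite prednK //; have [Px|nPx] := pselect (P x); last first.
    by elim: (N) => // n IH; rewrite iterS IH unP.
  suff uX n : iter n u x = (f ^+ n)%g x by rewrite uX.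
  elim: n => // n IH; rewrite iterS IH uP ?ietXS //.
  by elim: (n) => // m Pm; rewrite ietXS; apply/Pf.
have f'P x : P (f' x) <-> P x.
  rewrite f'E; have [Px|nPx] := pselect (P x); last by rewrite unP.
  by rewrite uP // Pf.
have f'per : periodic f'.
  exists N => //; apply/ietP => x; rewrite iet1E.
  have [Px|nPx] := pselect (P x); last first.
    by elim: (N) => // n IH; rewrite ietXS IH f'E unP.
  suff f'X n : (f' ^+ n)%g x = (f ^+ n)%g x by rewrite f'X.
  elim: n => // n IH; rewrite !ietXS IH f'E uP //.
  by elim: (n) => // m Pm; rewrite ietXS; apply/Pf.
have [t [t2 ftf torb]] := periodic_reflection f'per.
have tP x : P (t x) <-> P x.
  have [i ->] := torb x; elim: i => // i IH.
  by rewrite ietXS f'P.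
have tt x : t (t x) = x by rewrite -ietME -expg2 t2.
pose k x := if `[<P x>] then t x else if `[<A x>] then h x else (h^-1)%g x.
have kP x : P x -> k x = t x by move=> Px; rewrite /k (asboolT Px).
have kA x : ~ P x -> A x -> k x = h x
  by move=> nP Ax; rewrite /k (asboolF nP) (asboolT Ax).
have knA x : ~ P x -> ~ A x -> k x = (h^-1)%g x
  by move=> nP nA; rewrite /k (asboolF nP) (asboolF nA).
have PhV x : P ((h^-1)%g x) <-> P x by rewrite -Ph ietVK.
have ktwice x : P x \/ ~ E0 x -> k (k x) = x.
  have [Px _|nP [//|nE0]] := pselect (P x);
    first by rewrite (kP x) // kP ?tt ?tP.
  have [Ax|nAx] := pselect (A x).
    rewrite (kA x) // knA ?ietK ?Ph // Ah //; tauto.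
  have nPV : ~ P ((h^-1)%g x) by rewrite PhV.
  have nE0V : ~ E0 ((h^-1)%g x) by rewrite -E0h ietVK.
  rewrite (knA x) // kA ?ietVK //; apply: contrapT => /(Ah _ nPV nE0V).
  by rewrite ietVK.
have kq : iter q k =1 id.
  move=> x; have [[nP E0x]|] := pselect (~ P x /\ E0 x).
    suff kX n : iter n k x = (h ^+ n)%g x by rewrite kX.
    elim: n => // n IH; rewrite iterS IH ietXS kA //.
      by elim: (n) => // m; rewrite ietXS Ph.
    by left; elim: (n) => // m; rewrite ietXS E0h.
  move=> H; have /ktwice kkx : P x \/ ~ E0 x.
    by have [|nP] := pselect (P x); [left|right=> E0x; apply: H].
  by rewrite /q; elim: (p) => // m IH; rewrite addnS addSn !iterSr kkx.
have fkf x : f (k (f x)) = k x.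
  have [Px|nP] := pselect (P x).
    rewrite !kP ?Pf //; have /(congr1 (fun g : iet R => g x)) := ftf.
    by rewrite !ietME f'E uP ?tP ?f'E ?uP // Pf.
  have nPf : ~ P (f x) by rewrite Pf.
  have fhf y : f (h (f y)) = h y by rewrite (revX hf 1%N) ietVK.
  have [Ax|nA] := pselect (A x); first by rewrite !kA ?Af.
  rewrite !knA ?Af //; apply: (@iet_inj _ h); rewrite ietVK.
  by apply: (@iet_inj _ f); rewrite fhf ietVK.
have q0 : (0 < q)%N by rewrite addn_gt0 p0.
have [g gk] : exists g : iet R, g =1 k.
  apply: (@iet_of_iter _ _ q.-1); last by rewrite prednK.
  by apply: pt_if => //; [exact: iet_pt|apply: pt_if => //; exact: iet_pt].
exists g; first by apply/ietP => x; rewrite !ietME !gk.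
exists q => //; apply/ietP => x; rewrite iet_fun_iter (eq_iter gk) kq.
by [].
Qed.

End Assembly.

Theorem corollary4 (R : realType) :
  (forall f : iet R, periodic f ->
     exists2 n : nat, (n <= 2)%N & involution_product n f) /\
  (forall f : iet R, reversible f -> involution_product 4 f).
Proof.
split=> [f /periodic_involutions[a [b [a2 b2 ->]]]|f [h hf]].
  exists 2%N => //; exists [tuple a; b];
    last by rewrite !big_ord_recl big_ord0 mulg1.
  by case=> -[|[|]].
have [g fgf pg] := periodic_reverser hf.
have [a [b [a2 b2 fgE]]] := periodic_involutions (reversed_by_periodic fgf pg).
have [c [d [c2 d2 gE]]] := periodic_involutions (periodicV pg).
exists [tuple a; b; c; d]; first by case=> -[|[|[|[|]]]].
by rewrite !big_ord_recl big_ord0 mulg1 /= mulgA /tnth /= -fgE -gE mulgK.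
Qed.
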